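(* Let $G$ be a torsionfree abelian group, let $R$ be a commutative Noetherian $G$-graded ring, let $M$ be a finitely generated $G$-graded $R$-module, and let $N$ be a $G$-graded submodule of $M$ which is primary in $M$. Then $N$ is graded-irreducible in $M$ if and only if $N$ is irreducible in $M$.
   Context: A ring $R$ is $G$-graded if $R=\bigoplus_{g\in G}R_g$ with additive subgroups $R_g$ satisfying $R_gR_h\subset R_{g+h}$; an $R$-module $M$ is $G$-graded if $M=\bigoplus_{g\in G}M_g$ with additive subgroups $M_g$ satisfying $R_gM_h\subset M_{g+h}$. A graded submodule is a submodule generated by homogeneous elements. A submodule $N\subset M$ is irreducible if whenever $N_1,N_2$ are submodules of $M$ with $N_1\cap N_2=N$, then $N_1=N$ or $N_2=N$. A graded submodule $N$ of a graded module $M$ is graded-irreducible if whenever $N_1,N_2$ are $G$-graded submodules of $M$ with $N_1\cap N_2=N$, then $N_1=N$ or $N_2=N$. A submodule $N\subset M$ is primary if $M/N$ has exactly one associated prime. *)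

(* Defs.v *)
From HB Require Import structures.
From mathcomp Require Import all_boot all_order all_algebra.
From mathcomp Require Import generic_quotient ring_quotient boolp classical_sets.

Set Implicit Arguments.
Unset Strict Implicit.
Unset Printing Implicit Defensive.

Import GRing.Theory.
Local Open Scope ring_scope.
Local Open Scope quotient_scope.

(* Submodules of M are the elements of [submodClosed M], ideals of R those of
   [submodClosed R^o], and equality of such predicates is [=i].  These
   predicates are boolean, which with the classical axioms of [boolp] is no
   restriction: every submodule given as a Prop-valued set arises this way. *)
Lemma submod_of_set (R : pzRingType) (M : lmodType R) (A : set M) :
    A 0 -> (forall (a : R) (x y : M), A x -> A y -> A (a *: x + y)) ->
  exists N : submodClosed M, forall x, x \in N <-> A x.
Proof.
move=> A0 AL.
have AP : GRing.submod_closed (fun x : M => `[< A x >]).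
  split; first exact/asboolP.
  by move=> a x y /asboolP Ax /asboolP Ay; apply/asboolP/AL.
pose S := GRing.isSubmodClosed.Build R M (fun x : M => `[< A x >]) AP.
pose N : submodClosed M := HB.pack (fun x : M => `[< A x >]) S.
by exists N => x; split => /asboolP.
Qed.

Section QuotientModule.
Variables (R : pzRingType) (M : lmodType R) (N : submodClosed M).

(* [submodClosed] covers semimodules, so it does not inherit [zmodClosed]. *)
Definition submod_pred : {pred M} := [in N].
Fact submod_pred_zmod_closed : zmod_closed submod_pred.
Proof. exact: GRing.submod_closedB (submodClosedP N). Qed.
HB.instance Definition _ := GRing.isZmodClosed.Build M submod_pred
  submod_pred_zmod_closed.

Definition quotmod : Type := {ideal_quot submod_pred}.
HB.instance Definition _ := GRing.Zmodule.on quotmod.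
HB.instance Definition _ := Quotient.on quotmod.

Definition quotmod_scale (a : R) (x : quotmod) : quotmod :=
  \pi_quotmod (a *: repr x).

Lemma pi_quotmodE (x y : M) : (\pi_quotmod x == \pi_quotmod y) = (x - y \in N).
Proof. by rewrite (Quotient.idealrBE submod_pred). Qed.

Lemma pi_quotmodD (x y : M) :
  \pi_quotmod (x + y) = \pi_quotmod x + \pi_quotmod y.
Proof. exact: (Quotient.pi_add submod_pred). Qed.

Lemma pi_quotmodZ (a : R) (x : M) :
  \pi_quotmod (a *: x) = quotmod_scale a (\pi_quotmod x).
Proof.
apply/eqP; rewrite pi_quotmodE -scalerBr rpredZ //.
by rewrite -pi_quotmodE reprK.
Qed.

Lemma quotmod_surj (x : quotmod) : exists y : M, x = \pi_quotmod y.
Proof. by exists (repr x); rewrite reprK. Qed.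

Fact quotmod_scaleA a b x :
  quotmod_scale a (quotmod_scale b x) = quotmod_scale (a * b) x.
Proof. by have [y ->] := quotmod_surj x; rewrite -!pi_quotmodZ scalerA. Qed.

Fact quotmod_scale1 : left_id 1 quotmod_scale.
Proof.
by move=> x; have [y ->] := quotmod_surj x; rewrite -pi_quotmodZ scale1r.
Qed.

Fact quotmod_scaleDr : right_distributive quotmod_scale +%R.
Proof.
move=> a x y; have [u ->] := quotmod_surj x; have [v ->] := quotmod_surj y.
by rewrite -pi_quotmodD -!pi_quotmodZ scalerDr pi_quotmodD.
Qed.

Fact quotmod_scaleDl x : {morph quotmod_scale^~ x : a b / a + b}.
Proof.
move=> a b /=; have [y ->] := quotmod_surj x.
by rewrite -!pi_quotmodZ scalerDl pi_quotmodD.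
Qed.

HB.instance Definition _ := GRing.Zmodule_isLmodule.Build R quotmod
  quotmod_scaleA quotmod_scale1 quotmod_scaleDr quotmod_scaleDl.

End QuotientModule.

Definition torsionfree (G : zmodType) : Prop :=
  forall (g : G) (n : nat), (0 < n)%N -> g *+ n = 0 -> g = 0.

Definition generated_by (R : pzRingType) (M : lmodType R) (X S : {pred M}) :
    Prop :=
  {subset X <= S} /\
  forall N : submodClosed M, {subset X <= N} -> {subset S <= N}.

Definition noetherian (R : pzRingType) : Prop :=
  forall I : submodClosed R^o, exists s : seq R^o, generated_by [in s] I.

Definition finitely_generated (R : pzRingType) (M : lmodType R) : Prop :=
  exists s : seq M, generated_by [in s] predT.

Definition direct_sum (G : choiceType) (V : zmodType) (A : G -> zmodClosed V) :
    Prop :=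
  (forall x : V, exists (s : seq G) (f : G -> V),
     [/\ uniq s, forall g, f g \in A g & x = \sum_(g <- s) f g]) /\
  (forall (s : seq G) (f : G -> V), uniq s -> (forall g, f g \in A g) ->
     \sum_(g <- s) f g = 0 -> {in s, forall g, f g = 0}).

Definition ring_grading (G : zmodType) (R : pzRingType)
    (Rg : G -> zmodClosed R) : Prop :=
  direct_sum Rg /\
  forall (g h : G) (a b : R), a \in Rg g -> b \in Rg h -> a * b \in Rg (g + h).

Definition module_grading (G : zmodType) (R : pzRingType)
    (Rg : G -> zmodClosed R) (M : lmodType R) (Mg : G -> zmodClosed M) : Prop :=
  direct_sum Mg /\
  forall (g h : G) (a : R) (x : M),
    a \in Rg g -> x \in Mg h -> a *: x \in Mg (g + h).

Definition homogeneous (G : Type) (V : zmodType) (A : G -> zmodClosed V)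
    (x : V) : Prop :=
  exists g, x \in A g.

Definition graded_submodule (G : Type) (R : pzRingType) (M : lmodType R)
    (Mg : G -> zmodClosed M) (N : submodClosed M) : Prop :=
  exists X : {pred M}, {in X, forall x, homogeneous Mg x} /\ generated_by X N.

Definition irreducible_submodule (R : pzRingType) (M : lmodType R)
    (N : submodClosed M) : Prop :=
  forall N1 N2 : submodClosed M,
    [predI N1 & N2] =i N -> N1 =i N \/ N2 =i N.

Definition graded_irreducible (G : Type) (R : pzRingType) (M : lmodType R)
    (Mg : G -> zmodClosed M) (N : submodClosed M) : Prop :=
  forall N1 N2 : submodClosed M,
    graded_submodule Mg N1 -> graded_submodule Mg N2 ->
    [predI N1 & N2] =i N -> N1 =i N \/ N2 =i N.

Definition prime_ideal (R : comPzRingType) (P : submodClosed R^o) : Prop :=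
  1 \notin P /\
  forall a b : R, a * b \in P -> (a \in P) || (b \in P).

Definition associated_prime (R : comPzRingType) (L : lmodType R)
    (P : submodClosed R^o) : Prop :=
  prime_ideal P /\ exists x : L, forall a : R, (a \in P) = (a *: x == 0).

Definition primary_submodule (R : comPzRingType) (M : lmodType R)
    (N : submodClosed M) : Prop :=
  exists P : submodClosed R^o, associated_prime (quotmod N) P /\
    forall Q : submodClosed R^o, associated_prime (quotmod N) Q -> Q =i P.

(* Main.v *)
Require Import Defs.
From HB Require Import structures.
From mathcomp Require Import all_boot all_order all_algebra.
From mathcomp Require Import generic_quotient boolp.

Set Implicit Arguments.
Unset Strict Implicit.
Unset Printing Implicit Defensive.

Import GRing.Theory.
Local Open Scope ring_scope.

(** Irreducible submodules are graded-irreducible for a trivial reason; the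
content is the converse.  Call [colon N x] the annihilator of the class of [x]
in [M / N], and let [P] be the only associated prime of [M / N].

Torsionfreeness of [G] makes [P] graded.  Among the homogeneous [x] outside
[N], choose [x0] with [colon N x0] maximal; a product of two homogeneous ring
elements lies in this ideal only if a factor does.  Finite subsets of a
torsionfree abelian group have unique sums ([torsionfree_unique_sum]), and this
turns primality for homogeneous elements into primality
([graded_prime_is_prime]).  Hence [colon N x0] is an associated prime, that is
[P], and it is graded as the annihilator of a homogeneous class.

Now consider [S = {y | P y <= N}], the socle of [M / N] at [P].  It is graded,
[S / N] is a torsionfree module over the domain [R / P], and
graded-irreducibility says that any two homogeneous elements of [S] outside [N]
have a common multiple outside [N].  So all homogeneous elements of [S / N] lie
on the line spanned by [x0] over the fraction field of [R / P]; since they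
generate, [S / N] has rank one ([graded_irreducible_rank_one]).

Finally let [N1] and [N2] be submodules strictly larger than [N].  An element
of [Ni] outside [N] has a multiple with prime annihilator modulo [N]
([multiple_prime_colon]); this prime is associated, hence equal to [P], so [Ni]
meets [S] outside [N].  As [S / N] has rank one, [N1] and [N2] contain a common
multiple of [x0] that is not in [N], and [N1] meets [N2] in more than [N]. *)

(** Closure under subtraction is not inferred for submodules, which are also
meant for semirings; over a ring it follows by scaling by [-1]. *)
Lemma submodClosedB (R : pzRingType) (M : lmodType R) (N : submodClosed M) :
  {in N &, forall x y, x - y \in N}.
Proof. by move=> x y xN yN; rewrite -scaleN1r rpredD ?rpredZ. Qed.

(** * Unique sums in torsionfree abelian groups *)

Definition pointed_cone (G : zmodType) (C : G -> Prop) : Prop :=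
  [/\ C 0, forall x y, C x -> C y -> C (x + y)
    & forall x, C x -> C (- x) -> x = 0].

Lemma pointed_coneMn (G : zmodType) (C : G -> Prop) x n :
  pointed_cone C -> C x -> C (x *+ n).
Proof.
move=> [C0 CD _] Cx; elim: n => [|n IHn]; first by rewrite mulr0n.
by rewrite mulrS; apply: CD.
Qed.

(** If adjoining [f] destroys pointedness then a positive multiple of [- f] is
in [C], and if adjoining [- f] does then so is a positive multiple of [f].  A
common multiple of the two then lies in [C] with its opposite, hence vanishes,
and so does [f] because [G] is torsionfree. *)
Lemma pointed_cone_extend (G : zmodType) (C : G -> Prop) (f : G) :
    torsionfree G -> pointed_cone C ->
  exists2 D, pointed_cone D &
    (forall x, C x -> D x) /\ (D f \/ D (- f)).
Proof.
move=> tfG cC; have [C0 CD Cpt] := cC.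
pose D e x := exists c n, C c /\ x = c + e *+ n.
have DC e x : C x -> D e x by exists x, 0%N; rewrite mulr0n addr0.
have De e : D e e by exists 0, 1%N; rewrite add0r.
have cD e : (forall k, (0 < k)%N -> ~ C (- e *+ k)) -> pointed_cone (D e).
  move=> eNC; split; first exact: DC.
    move=> x y [c [n [Cc ->]]] [d [m [Cd ->]]].
    by exists (c + d), (n + m)%N; split; [exact: CD | rewrite mulrnDr addrACA].
  move=> x [c [n [Cc ->]]] [d [m [Cd]]] /eqP.
  rewrite eq_sym -addr_eq0 addrACA -mulrnDr addr_eq0 => /eqP cd.
  case nm: (m + n)%N => [|k].
    move/eqP: nm; rewrite addn_eq0 => /andP[/eqP m0 /eqP n0].
    move: cd; rewrite n0 m0 !mulr0n addr0 oppr0 => /eqP.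
    rewrite addr_eq0 => /eqP dc; apply: Cpt => //.
    by rewrite -dc.
  by case: (eNC k.+1) => //; rewrite mulNrn -nm -cd; exact: CD.
have [fN | /existsNP[k /not_implyP[k0 /contrapT Ck]]] :=
    pselect (forall k, (0 < k)%N -> ~ C (- f *+ k)).
  by exists (D f); [exact: cD | split; [exact: DC | left]].
have [fN | /existsNP[l /not_implyP[l0 /contrapT Cl]]] :=
    pselect (forall k, (0 < k)%N -> ~ C (- - f *+ k)).
  by exists (D (- f)); [exact: cD | split; [exact: DC | right]].
(* Both extensions fail: [C] contains [- f *+ k] and [f *+ l]. *)
suff f0 : f = 0.
  by exists C => //; split=> //; left; rewrite f0.
apply: (tfG f (k * l)%N); first by rewrite muln_gt0 k0.
apply: Cpt.
  by rewrite mulnC mulrnA; apply: pointed_coneMn => //; rewrite opprK in Cl.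
by rewrite -mulNrn mulrnA; exact: pointed_coneMn.
Qed.

(** A pointed cone [C] is the positive cone of the translation-invariant partial
order [C (y - x)].  This is a finite form of the orderability of torsionfree
abelian groups: some such order makes all elements of [F] comparable to [0]. *)
Lemma pointed_cone_total_on (G : zmodType) (F : seq G) : torsionfree G ->
  exists2 C, pointed_cone C & {in F, forall f, C f \/ C (- f)}.
Proof.
move=> tfG; elim: F => [|f F [C cC CF]].
  exists (eq^~ 0) => //; split=> // x y -> ->; exact: addr0.
have [D cD [CD Df]] := pointed_cone_extend f tfG cC.
exists D => // x /[!inE] /predU1P[-> // | /CF[] /CD]; by [left | right].
Qed.

Lemma pointed_cone_max (G : zmodType) (C : G -> Prop) (s : seq G) :
    pointed_cone C -> s != [::] ->
    {in s &, forall g h, C (g - h) \/ C (- (g - h))} ->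
  exists2 g, g \in s & {in s, forall h, C (g - h)}.
Proof.
move=> [C0 CD _]; elim: s => [//|g [|h s] IHs] _ tot.
  by exists g => [|x]; rewrite inE // => /eqP->; rewrite subrr.
have [//||m ms mmax] := IHs.
  by move=> x y xs ys; apply: tot; rewrite inE ?xs ?ys orbT.
have [||Cgm|Cmg] := tot g m; rewrite ?mem_head //.
- by rewrite inE ms orbT.
- exists g; rewrite ?mem_head // => x.
  rewrite in_cons => /predU1P[->|/mmax Cmx].
    by rewrite subrr.
  by rewrite -(subrKA m); exact: CD.
- exists m; first by rewrite inE ms orbT.
  by move=> x; rewrite in_cons => /predU1P[->|/mmax//]; rewrite -opprB.
Qed.

(** Order [G] partially so that [s] and [t] become chains; the sum of the two
maxima is attained only once. *)
Lemma torsionfree_unique_sum (G : zmodType) (s t : seq G) :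
    torsionfree G -> s != [::] -> t != [::] ->
  exists g h, [/\ g \in s, h \in t &
    forall g' h', g' \in s -> h' \in t -> g' + h' = g + h -> g' = g].
Proof.
move=> tfG s0 t0.
have [C cC CF] := pointed_cone_total_on
  ([seq x - y | x <- s, y <- s] ++ [seq x - y | x <- t, y <- t]) tfG.
have [|g gs gmax] := pointed_cone_max cC s0.
  move=> x y xs ys; apply: CF.
  by rewrite mem_cat (allpairs_f (fun x y => x - y)).
have [|h ht hmax] := pointed_cone_max cC t0.
  move=> x y xs ys; apply: CF.
  by rewrite mem_cat orbC (allpairs_f (fun x y => x - y)).
exists g, h; split=> // g' h' g's h't gh.
have [_ _ Cpt] := cC; apply/esym/eqP; rewrite -subr_eq0; apply/eqP/Cpt.
  exact: gmax.
suff -> : - (g - g') = h - h' by exact: hmax.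
by apply/eqP; rewrite opprB subr_eq addrAC eq_sym subr_eq gh addrC.
Qed.

(** * Homogeneous components *)

Section Components.
Variables (G : choiceType) (V : zmodType) (A : G -> zmodClosed V).
Hypothesis dA : direct_sum A.

(** The index list of some chosen decomposition of [x]: components may vanish at
some of its members. *)
Definition support (x : V) : seq G := sval (cid (proj1 dA x)).

Definition component (g : G) (x : V) : V :=
  if g \in support x then sval (cid (svalP (cid (proj1 dA x)))) g else 0.

Lemma support_uniq x : uniq (support x).
Proof. by rewrite /support; case: cid => s /= [f []]. Qed.

Lemma component_in g x : component g x \in A g.
Proof.
rewrite /component; case: ifP => _; last exact: rpred0.
by case: (cid (svalP (cid (proj1 dA x)))) => f /= [].
Qed.

Lemma component_out g x : g \notin support x -> component g x = 0.
Proof. by rewrite /component => /negPf->. Qed.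

Lemma component_sum x : x = \sum_(g <- support x) component g x.
Proof.
have -> : \sum_(g <- support x) component g x =
    \sum_(g <- support x) sval (cid (svalP (cid (proj1 dA x)))) g.
  by apply: eq_big_seq => g gx; rewrite /component gx.
by case: (cid (svalP (cid (proj1 dA x)))) => f /= [].
Qed.

Lemma sum_widen (s u : seq G) (f : G -> V) : uniq s -> uniq u ->
    {subset s <= u} -> (forall g, g \notin s -> f g = 0) ->
  \sum_(g <- s) f g = \sum_(g <- u) f g.
Proof.
move=> us uu su f0; rewrite [RHS](bigID (mem s)) /= [X in _ + X]big1 ?addr0 //.
rewrite -[RHS]big_filter; apply/perm_big/uniq_perm => [||g].
- exact: us.
- exact: filter_uniq.
- by rewrite mem_filter; case gs: (g \in s) => //=; rewrite su.
Qed.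

Lemma component_sum_widen (x : V) (u : seq G) :
  uniq u -> {subset support x <= u} -> x = \sum_(g <- u) component g x.
Proof.
move=> uu xu; rewrite [LHS]component_sum.
by apply: sum_widen => // [|g]; [exact: support_uniq | exact: component_out].
Qed.

(** Components do not depend on the chosen decomposition; every other fact about
them follows by exhibiting a decomposition. *)
Lemma component_unique (x : V) (s : seq G) (f : G -> V) g : uniq s ->
    (forall h, f h \in A h) -> (forall h, h \notin s -> f h = 0) ->
  x = \sum_(h <- s) f h -> component g x = f g.
Proof.
move=> us fA f0 xs; pose u := undup (g :: s ++ support x).
have uu : uniq u by exact: undup_uniq.
apply/eqP; rewrite -subr_eq0; apply/eqP.
have := proj2 dA u (fun h => component h x - f h) uu _ _ g; apply.
- by move=> h; rewrite rpredB ?component_in.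
- rewrite sumrB -(sum_widen (f := f) us uu) //; last first.
    by move=> h hs; rewrite mem_undup inE mem_cat hs orbT.
  rewrite -(component_sum_widen uu) -?xs ?subrr // => h hs.
  by rewrite mem_undup inE mem_cat hs !orbT.
- by rewrite mem_undup mem_head.
Qed.

Lemma component_is_zmod_morphism g : zmod_morphism (component g).
Proof.
move=> x y; pose u := undup (support x ++ support y).
have uu : uniq u by exact: undup_uniq.
apply: (component_unique (f := fun h => component h x - component h y) _ uu).
- by move=> h; rewrite rpredB ?component_in.
- move=> h; rewrite mem_undup mem_cat => /norP[hx hy].
  by rewrite !component_out ?subrr.
- rewrite sumrB -(component_sum_widen uu); last first.
    by move=> h hs; rewrite mem_undup mem_cat hs.
  rewrite -(component_sum_widen uu) // => h hs.
  by rewrite mem_undup mem_cat hs orbT.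
Qed.

HB.instance Definition _ g :=
  GRing.isZmodMorphism.Build V V (component g) (component_is_zmod_morphism g).

Lemma component_homogeneous g x : x \in A g -> component g x = x.
Proof.
move=> xA.
rewrite (@component_unique x [:: g] (fun h => if h == g then x else 0)) //.
- by rewrite eqxx.
- by move=> h; case: eqP => [->//|_]; exact: rpred0.
- by move=> h; rewrite inE => /negPf->.
- by rewrite big_seq1 eqxx.
Qed.

Lemma component_homogeneous_neq g h x :
  x \in A g -> h != g -> component h x = 0.
Proof.
move=> xA /negPf hg.
rewrite (@component_unique x [:: g] (fun h => if h == g then x else 0)) //.
- by rewrite hg.
- by move=> k; case: eqP => [->//|_]; exact: rpred0.
- by move=> k; rewrite inE => /negPf->.
- by rewrite big_seq1 eqxx.
Qed.

End Components.

(** * Graded submodules *)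

Section GradedModules.
Variables (G : zmodType) (R : comPzRingType) (Rg : G -> zmodClosed R).
Variables (M : lmodType R) (Mg : G -> zmodClosed M).
Hypotheses (gR : ring_grading Rg) (gM : module_grading Rg Mg).

Let dR : direct_sum Rg := proj1 gR.
Let dM : direct_sum Mg := proj1 gM.

Lemma component_scale_homogeneous g k (a : R) (x : M) : a \in Rg g ->
  component dM k (a *: x) = a *: component dM (k - g) x.
Proof.
move=> ag.
apply: (@component_unique _ _ _ dM _ [seq g + h | h <- support dM x]
  (fun j => a *: component dM (j - g) x)).
- by rewrite map_inj_uniq ?support_uniq //; exact: addrI.
- move=> h; rewrite -{2}(subrKC g h); apply: (proj2 gM) => //.
  exact: component_in.
- move=> h hs; rewrite component_out ?scaler0 //; apply: contra hs => hs.
  by rewrite -(subrKC g h) map_f.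
- rewrite big_map [in LHS](component_sum dM x) scaler_sumr.
  by apply: eq_bigr => h _; rewrite addrC addKr.
Qed.

Lemma component_scale k (a : R) (x : M) :
  component dM k (a *: x) =
  \sum_(g <- support dR a) component dR g a *: component dM (k - g) x.
Proof.
rewrite [in LHS](component_sum dR a) scaler_suml raddf_sum.
apply: eq_bigr => g _; apply: component_scale_homogeneous.
exact: component_in.
Qed.

Lemma component_scale_of_homogeneous g h (a : R) (x : M) : x \in Mg h ->
  component dM (g + h) (a *: x) = component dR g a *: x.
Proof.
move=> xh; rewrite component_scale -[RHS]addr0.
have [gs|gs] := boolP (g \in support dR a); last first.
  rewrite (component_out gs) scale0r add0r big_seq big1 // => k ks.
  rewrite (component_homogeneous_neq dM xh) ?scaler0 //.
  rewrite addrAC -subr_eq0 addrK subr_eq0.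
  by apply: contraNneq gs => ->.
rewrite (bigD1_seq g) ?support_uniq //=; congr (_ *: _ + _).
  by rewrite addrC addKr (component_homogeneous dM xh).
rewrite big1 // => k kg.
rewrite (component_homogeneous_neq dM xh) ?scaler0 //.
by rewrite addrAC -subr_eq0 addrK subr_eq0 eq_sym.
Qed.

(** Generation by homogeneous elements is awkward to use; closure under
components is not.  The submodule [K] of elements with all components in [N]
contains the homogeneous generators of [N], hence [N]. *)
Lemma graded_submoduleP (N : submodClosed M) :
  graded_submodule Mg N <-> (forall x g, x \in N -> component dM g x \in N).
Proof.
split=> [[X [hX [XN genX]]] x g xN | NC].
  have [K KP] : exists K : submodClosed M,
      forall x, x \in K <-> forall h, component dM h x \in N.
    apply: submod_of_set => [h|a y z yN zN h]; first by rewrite raddf0 rpred0.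
    rewrite raddfD rpredD //= component_scale.
    by apply: rpred_sum => k _; exact: rpredZ.
  suff : x \in K by move/KP; apply.
  apply: genX xN => y yX; apply/KP => h; have [k yk] := hX _ yX.
  have [->|hk] := eqVneq h k.
    by rewrite (component_homogeneous dM yk) XN.
  by rewrite (component_homogeneous_neq dM yk) ?rpred0.
exists (fun x => `[< x \in N /\ homogeneous Mg x >]); split.
  by move=> x /asboolP[].
split=> [x /asboolP[]//|K XK x xN].
rewrite (component_sum dM x); apply: rpred_sum => g _; apply/XK/asboolP.
split; [exact: NC | exists g; exact: component_in].
Qed.

Lemma component_notin (N : submodClosed M) x :
  x \notin N -> exists g, component dM g x \notin N.
Proof.
move=> xN; apply: contrapT => /forallNP h; move/negP: xN; apply.
rewrite (component_sum dM x); apply: rpred_sum => g _.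
exact/negPn/negP/h.
Qed.

End GradedModules.

(** * Graded prime ideals *)

(** Given [a] and [b] outside [Q], take a unique sum [g + h] of degrees of
components of [a] and of [b] outside [Q].  In the component of [a * b] of degree
[g + h], all terms but [a_g * b_h] have a factor in [Q], so [a_g * b_h] would be
in [Q] if [a * b] were. *)
Lemma graded_prime_is_prime (G : zmodType) (R : comPzRingType)
    (Rg : G -> zmodClosed R) (gR : ring_grading Rg) (Q : submodClosed R^o) :
    torsionfree G ->
    (forall g a, a \in Q -> component (proj1 gR) g a \in Q) -> 1 \notin Q ->
    (forall a b, homogeneous Rg a -> homogeneous Rg b ->
       a * b \in Q -> (a \in Q) || (b \in Q)) ->
  prime_ideal Q.
Proof.
pose dR := proj1 gR; move=> tfG gQ Q1 Qhom; split=> // a b abQ.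
apply/contraT => /norP[aQ bQ].
pose s c := [seq g <- support dR c | component dR g c \notin Q].
have s0 c : c \notin Q -> s c != [::].
  apply: contraNneq => sc0; rewrite (component_sum dR c) big_seq.
  apply: rpred_sum => g gs; apply: contraT => gQ'.
  by rewrite -(in_nil g) -sc0 mem_filter gQ' gs.
have sQ c g : g \notin s c -> component dR g c \in Q.
  rewrite mem_filter negb_and negbK => /orP[//|/component_out ->].
  exact: rpred0.
have [g [h [gs hs gh]]] := torsionfree_unique_sum tfG (s0 a aQ) (s0 b bQ).
have abE : component dR (g + h) (a * b) = \sum_(k <- support dR a)
    component dR k a * component dR (g + h - k) b.
  exact: (component_scale gR (gR : module_grading Rg (M := R^o) Rg)).
have : component dR g a * component dR h b \in Q.
  have := gQ (g + h) _ abQ; rewrite abE.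
  rewrite (bigD1_seq g) ?support_uniq //=; last first.
    by move: gs; rewrite mem_filter => /andP[].
  rewrite addrAC subrr add0r => sumQ; rewrite -[X in X \in Q](addrK
    (\sum_(k <- support dR a | k != g)
       component dR k a * component dR (g + h - k) b)).
  apply: (submodClosedB sumQ); apply: rpred_sum => k kg.
  have [ks|/sQ kQ] := boolP (k \in s a); last first.
    by rewrite mulrC; apply: (rpredZ (V := R^o)).
  apply: (rpredZ (V := R^o)); apply: sQ; apply/negP => hk.
  by move/eqP: kg; apply; apply: gh ks hk _; rewrite subrKC.
move/Qhom; rewrite (negPf (_ : component dR g a \notin Q)); last first.
  by move: gs; rewrite mem_filter => /andP[].
rewrite (negPf (_ : component dR h b \notin Q)); last first.
  by move: hs; rewrite mem_filter => /andP[].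
apply; [exists g | exists h]; exact: component_in.
Qed.

(** * Annihilators modulo a submodule *)

Section Colon.
Variables (R : comPzRingType) (M : lmodType R) (N : submodClosed M) (x : M).

Definition colon : {pred R^o} := fun a => (a : R) *: x \in N.

Fact colon_submod_closed : GRing.submod_closed colon.
Proof.
split; first by rewrite unfold_in scale0r rpred0.
move=> a b c bN cN; rewrite unfold_in scalerDl rpredD //.
by rewrite -scalerA rpredZ.
Qed.
HB.instance Definition _ :=
  GRing.isSubmodClosed.Build R R^o colon colon_submod_closed.

Lemma colonE (a : R^o) : (a \in colon) = ((a : R) *: x \in N).
Proof. by []. Qed.

End Colon.

Lemma associated_prime_quotmodP (R : comPzRingType) (M : lmodType R)
    (N : submodClosed M) (P : submodClosed R^o) :
  associated_prime (quotmod N) P <-> prime_ideal P /\ exists x, P =i colon N x.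
Proof.
have E x (a : R) :
    (a *: (\pi_(quotmod N)%qT x : quotmod N) == 0) = (a *: x \in N).
  rewrite -[a *: _](pi_quotmodZ N a x).
  have -> : 0 = (\pi_(quotmod N)%qT (0 : M) : quotmod N).
    by apply: (addIr (\pi_(quotmod N)%qT (0:M))); rewrite -pi_quotmodD !add0r.
  by rewrite pi_quotmodE subr0.
split=> -[pP [x Px]]; split=> //.
  have [y xy] := quotmod_surj x; exists y => a.
  by rewrite Px xy E colonE.
by exists (\pi_(quotmod N)%qT x) => a; rewrite Px E.
Qed.

(** The maximum principle for noetherian rings, in indexed form so that the
ideals may be annihilators of a restricted class of elements.  Without a maximal
member, dependent choice yields a strictly increasing sequence [J] of ideals;
the union [U] is finitely generated, hence equal to some [J n]. *)
Lemma noetherian_maximal (R : pzRingType) (T : Type) (D : T -> Prop)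
    (I : T -> submodClosed R^o) :
    noetherian R -> (exists t, D t) ->
  exists2 t, D t & forall u, D u -> {subset I t <= I u} -> {subset I u <= I t}.
Proof.
move=> nR [t0 Dt0]; apply: contrapT => nmax.
have step (t : {t | D t}) :
    exists u : {t | D t}, {subset I (sval t) <= I (sval u)} /\
      ~ {subset I (sval u) <= I (sval t)}.
  case: t => t Dt /=; apply: contrapT => /forallNP h; apply: nmax.
  exists t => // u Du tu; apply: contrapT => ut.
  exact: (h (exist _ u Du)).
have [next nextP] := choice step.
pose J n := I (sval (iter n next (exist _ t0 Dt0))).
have JS n : {subset J n <= J n.+1} by exact: (proj1 (nextP _)).
have Jle m n : (m <= n)%N -> {subset J m <= J n}.
  move=> /subnK <-; elim: (n - m)%N => [//|k IHk] a /IHk; exact: JS.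
have [U UP] : exists U : submodClosed R^o,
    forall a, a \in U <-> exists n, a \in J n.
  apply: submod_of_set => [|a b c [m bm] [n cn]].
    by exists 0%N; rewrite rpred0.
  exists (maxn m n); rewrite rpredD ?rpredZ //.
    exact: Jle (leq_maxl _ _) _ bm.
  exact: Jle (leq_maxr _ _) _ cn.
have [s [sU genU]] := nR U.
have [n sJ] : exists n, {subset s <= J n}.
  elim: s sU {genU} => [_|a s IHs asU]; first by exists 0%N.
  have [|n sn] := IHs; first by move=> b bs; apply: asU; rewrite inE bs orbT.
  have /UP[m am] : a \in U by apply: asU; rewrite inE eqxx.
  exists (maxn m n) => b /[!inE] /predU1P[->|/sn].
    exact: Jle (leq_maxl _ _) _ am.
  exact: Jle (leq_maxr _ _) _.
case: (nextP (iter n next (exist _ t0 Dt0))) => _; apply=> a aJ.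
by apply: (genU _ sJ); apply/UP; exists n.+1.
Qed.

(** The classical existence of associated primes: a maximal annihilator among
the multiples of [x] outside [N] is prime. *)
Lemma multiple_prime_colon (R : comPzRingType) (M : lmodType R)
    (N : submodClosed M) (x : M) :
    noetherian R -> x \notin N ->
  exists2 b : R, b *: x \notin N & prime_ideal (colon N (b *: x)).
Proof.
move=> nR xN.
have [|b bN bmax] := @noetherian_maximal R R (fun b => b *: x \notin N)
    (fun b => colon N (b *: x)) nR.
  by exists 1; rewrite scale1r.
exists b => //; split; first by rewrite colonE scale1r.
move=> a c; rewrite !colonE => acN; case cN: (c *: (b *: x) \in N).
  by rewrite orbT.
rewrite orbF -[_ \in N]/(a \in colon N (b *: x)).
apply: (bmax (c * b)); rewrite -?scalerA ?cN //.
  move=> d; rewrite !colonE [d *: (c *: _)]scalerA mulrC -scalerA.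
  exact: rpredZ.
by rewrite colonE scalerA.
Qed.

(** * Homogeneous elements with prime annihilator *)

Section GradedColon.
Variables (G : zmodType) (R : comPzRingType) (Rg : G -> zmodClosed R).
Variables (M : lmodType R) (Mg : G -> zmodClosed M) (N : submodClosed M).
Hypotheses (gR : ring_grading Rg) (gM : module_grading Rg Mg).
Hypothesis gN : graded_submodule Mg N.

Let dR : direct_sum Rg := proj1 gR.
Let dM : direct_sum Mg := proj1 gM.

Lemma component_colon (x : M) (g : G) (a : R) : homogeneous Mg x ->
  a \in colon N x -> component dR g a \in colon N x.
Proof.
move=> [h xh]; rewrite !colonE -(component_scale_of_homogeneous gR gM _ _ xh).
exact: (graded_submoduleP gR gM N).1.
Qed.

(** Maximality of [colon N x] among homogeneous [x] outside [N] gives primality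
for homogeneous elements only, since multiplying [x] by an inhomogeneous element
leaves this class; [graded_prime_is_prime] supplies the rest. *)
Lemma homogeneous_prime_colon : noetherian R -> torsionfree G ->
    (exists x, x \notin N) ->
  exists x, [/\ homogeneous Mg x, x \notin N & prime_ideal (colon N x)].
Proof.
move=> nR tfG [y yN]; have [g ygN] := component_notin gM yN.
have [|x [xh xN] xmax] := @noetherian_maximal R M
    (fun x => homogeneous Mg x /\ x \notin N) (colon N) nR.
  by exists (component dM g y); split=> //; exists g; exact: component_in.
exists x; split=> //; apply: (graded_prime_is_prime (gR := gR)) => //.
- by move=> h a; exact: component_colon.
- by rewrite colonE scale1r.
move=> a b _ bh abN; apply/orP; case bN: (b \in colon N x); [by right | left].
apply: (xmax (b *: x)).
- split; last by rewrite -colonE bN.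
  have [k xk] := xh; have [l bl] := bh; exists (l + k); exact: (proj2 gM).
- by move=> d; rewrite !colonE scalerA mulrC -scalerA; exact: rpredZ.
- by rewrite colonE scalerA.
Qed.

(** The part of [M / N] killed by a graded ideal is graded: it is enough to test
against the homogeneous components of the elements of the ideal. *)
Lemma colon_component (P : submodClosed R^o) (y : M) (g : G) :
    (forall k a, a \in P -> component dR k a \in P) ->
    {subset P <= colon N y} -> {subset P <= colon N (component dM g y)}.
Proof.
move=> gP Py p pP; rewrite colonE (component_sum dR p) scaler_suml.
apply: rpred_sum => k _; have /Py := gP k _ pP; rewrite colonE => pyN.
have := (graded_submoduleP gR gM N).1 gN _ (k + g) pyN.
rewrite (component_scale_homogeneous gM (g := k)); last exact: component_in.
by rewrite addrAC subrr add0r.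
Qed.

(** * Graded-irreducible submodules *)

(** The submodules [N + R x] and [N + R y] are graded and strictly contain [N],
so they meet outside [N]. *)
Lemma graded_irreducible_common_multiple (x y : M) : graded_irreducible Mg N ->
    homogeneous Mg x -> homogeneous Mg y -> x \notin N -> y \notin N ->
  exists a b : R, a *: x - b *: y \in N /\ b *: y \notin N.
Proof.
move=> irrN hx hy xN yN.
have adjoin z : homogeneous Mg z -> exists K : submodClosed M,
    graded_submodule Mg K /\
    (forall w, w \in K <-> exists n a, n \in N /\ w = n + a *: z).
  move=> [h zh]; have [K KP] : exists K : submodClosed M,
      forall w, w \in K <-> exists n a, n \in N /\ w = n + a *: z.
    apply: submod_of_set => [|a u v [m [b [mN ->]]] [n [c [nN ->]]]].
      by exists 0, 0; rewrite rpred0 scale0r addr0.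
    exists (a *: m + n), (a * b + c); rewrite rpredD ?rpredZ //; split=> //.
    by rewrite scalerDr scalerDl scalerA addrACA.
  exists K; split=> //; apply/(graded_submoduleP gR gM) => w g.
  move=> /KP[n [a [nN ->]]]; rewrite raddfD /=; apply: rpredD.
    apply/KP; exists (component dM g n), 0; rewrite scale0r addr0; split=> //.
    exact: (graded_submoduleP gR gM N).1.
  rewrite (component_scale gR gM); apply: rpred_sum => k _; apply: rpredZ.
  have [->|kh] := eqVneq (g - k) h.
    rewrite (component_homogeneous _ zh); apply/KP.
    by exists 0, 1; rewrite rpred0 scale1r add0r.
  by rewrite (component_homogeneous_neq _ zh kh) rpred0.
have NK z (K : submodClosed M) :
    (forall w, w \in K <-> exists n a, n \in N /\ w = n + a *: z) ->
    {subset N <= K} /\ z \in K.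
  move=> KP; split=> [w wN|]; apply/KP.
    by exists w, 0; rewrite scale0r addr0.
  by exists 0, 1; rewrite rpred0 scale1r add0r.
have [K [gK KP]] := adjoin x hx; have [L [gL LP]] := adjoin y hy.
have [NsubK xK] := NK _ _ KP; have [NsubL yL] := NK _ _ LP.
have : ~ [predI K & L] =i N.
  case/(irrN _ _ gK gL) => E; first by move: xN; rewrite -E xK.
  by move: yN; rewrite -E yL.
move/existsNP => [w /eqP]; rewrite inE /= => wKLN.
have wN : w \notin N.
  by apply: contra wKLN => wN; rewrite wN NsubK ?NsubL.
move: wKLN; rewrite (negPf wN) eqbF_neg negbK => /andP[/KP[m [a [mN wa]]]].
move=> /LP[n [b [nN wb]]]; exists a, b; split.
  have -> : a *: x - b *: y = n - m.
    by apply/eqP; rewrite subr_eq addrAC -wb wa [m + _]addrC addrK.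
  exact: submodClosedB.
by apply: contra wN => byN; rewrite wb rpredD.
Qed.

(** Over the domain [R / P] this says that every element of [M / N] killed by
[P] is, up to a nonzero factor, a multiple of [x0].  The elements with this
property are closed under addition (take a common denominator), which reduces
the claim to homogeneous [y]. *)
Lemma graded_irreducible_rank_one (P : submodClosed R^o) (x0 y : M) :
    prime_ideal P -> (forall k a, a \in P -> component dR k a \in P) ->
    graded_irreducible Mg N -> homogeneous Mg x0 -> x0 \notin N ->
    {subset P <= colon N y} ->
  exists b a : R, b \notin (P : {pred R^o}) /\ b *: y - a *: x0 \in N.
Proof.
move=> [P1 PM] gP girr x0h x0N Py; rewrite (component_sum dM y).
elim/big_ind : _ => [|u v [b [a [bP uN]]] [d [c [dP vN]]]|g _].
- by exists 1, 0; rewrite scaler0 scale0r subr0 rpred0.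
- exists (d * b), (d * a + b * c); split.
    by apply/negP => /PM; rewrite (negPf bP) (negPf dP).
  rewrite scalerDr scalerDl opprD addrACA -!scalerA.
  by rewrite [d *: (b *: v)]scalerA mulrC -scalerA -!scalerBr rpredD ?rpredZ.
set z := component _ g y; have [zN|zN] := boolP (z \in N).
  by exists 1, 0; rewrite scale1r scale0r subr0.
have zh : homogeneous Mg z by exists g; exact: component_in.
have [a [b [abN byN]]] :=
  graded_irreducible_common_multiple girr x0h zh x0N zN.
exists b, a; split; last by rewrite -opprB -sub0r submodClosedB ?rpred0.
by apply: contra byN => /(colon_component g gP Py).
Qed.

End GradedColon.

Theorem theorem4p3 (G : zmodType) (R : comPzRingType)
    (Rg : G -> zmodClosed R) (M : lmodType R) (Mg : G -> zmodClosed M)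
    (N : submodClosed M) :
  torsionfree G ->
  noetherian R ->
  ring_grading Rg ->
  finitely_generated M ->
  module_grading Rg Mg ->
  graded_submodule Mg N ->
  primary_submodule N ->
  graded_irreducible Mg N <-> irreducible_submodule N.
Proof.
move=> tfG nR gR _ gM gN [P [/associated_prime_quotmodP[prP [x Px]] uniqP]].
have [P1 PM] := prP; split=> [girr | irr N1 N2 _ _]; last exact: irr.
have colonP y : prime_ideal (colon N y) -> colon N y =i P.
  move=> pr; apply: uniqP; apply/associated_prime_quotmodP.
  by split=> //; exists y.
have [|x0 [x0h x0N /colonP x0P]] := homogeneous_prime_colon gR gM gN nR tfG.
  by exists x; move: P1; rewrite Px colonE scale1r.
have gP g a : a \in P -> component (proj1 gR) g a \in P.
  by rewrite -!x0P; exact: (component_colon gR gM gN).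
have x0NP a : a *: x0 \in N -> a \in P by rewrite -x0P.
(* A submodule strictly above [N] meets the line of [x0] outside [N]. *)
have escape (K : submodClosed M) : {subset N <= K} -> ~ (K =i N) ->
    exists2 a : R, a \notin (P : {pred R^o}) &
      exists2 w, w \in K & w - a *: x0 \in N.
  move=> NK /existsNP[u uKN]; have [uK uN] : u \in K /\ u \notin N.
    have [uN|uN] := boolP (u \in N); first by case: uKN; rewrite uN NK.
    split=> //; apply/contraT => uK; case: uKN.
    by rewrite (negPf uN) (negPf uK).
  have [b buN /colonP buP] := multiple_prime_colon nR uN.
  have [|d [a [dP daN]]] := graded_irreducible_rank_one gM gN (y := b *: u)
    prP gP girr x0h x0N; first by move=> p; rewrite buP.
  exists a; last by exists (d *: (b *: u)); rewrite ?rpredZ.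
  apply: contra dP; rewrite -x0P -buP !colonE => aN.
  by rewrite -(subrK (a *: x0) (d *: _)) rpredD.
move=> N1 N2 N12; apply: contrapT => /not_orP[N1N N2N].
have NN x1 : x1 \in N -> (x1 \in N1) /\ (x1 \in N2).
  by rewrite -N12 => /andP.
have [a aP [v vN1 vaN]] := escape N1 (fun z zN => (NN z zN).1) N1N.
have [b bP [w wN2 wbN]] := escape N2 (fun z zN => (NN z zN).2) N2N.
(* The common multiple of [N1] and [N2] on this line: [b * a] is not in [P]. *)
suff : (b * a) *: x0 \in N.
  by move/x0NP/PM; rewrite (negPf aP) (negPf bP).
rewrite -N12; apply/andP; split.
  rewrite -scalerA; apply: rpredZ; rewrite -[a *: x0](subKr v) submodClosedB //.
  by case: (NN _ vaN).
rewrite mulrC -scalerA; apply: rpredZ.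
rewrite -[b *: x0](subKr w) submodClosedB //.
by case: (NN _ wbN).
Qed.
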